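(* There are universal constants $0<c\le C<\infty$ such that for every integer $n\ge2$, the symmetric group $S_n$ equipped with the metric $d(\sigma,\pi)=|\{i\in\{1,\ldots,n\}:\ \sigma(i)\ne\pi(i)\}|$ satisfies $$c\sqrt{n}\ \le\ c_2(S_n,d)\ \le\ C\sqrt n .$$ Thus $c_2(S_n,d)=\Theta\left(\sqrt{\frac{\log|S_n|}{\log\log|S_n|}}\right)$ as $n\to\infty$.
   Context: Distortion: for metric spaces $(X,d_X),(Y,d_Y)$ and $f:X\to Y$, $\|f\|_{\mathrm{Lip}}=\sup_{x\ne y} d_Y(f(x),f(y))/d_X(x,y)$. If $f$ is one-to-one, $\mathrm{dist}(f)=\|f\|_{\mathrm{Lip}}\cdot\|f^{-1}\|_{\mathrm{Lip}}$ (with $f^{-1}$ defined on $f(X)$); otherwise $\mathrm{dist}(f)=\infty$. $c_Y(X)=\inf\{\mathrm{dist}(f): f:X\to Y\}$, and $c_2(X)=c_{L_2}(X)$ (Hilbert space). *)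

(* Defs.v *)
From HB Require Import structures.
From mathcomp Require Import all_boot all_order all_algebra perm.
From mathcomp Require Import all_classical all_reals all_analysis.
From mathcomp Require Import measurable_realfun.

Set Implicit Arguments.
Unset Strict Implicit.
Unset Printing Implicit Defensive.

Import Order.TTheory GRing.Theory Num.Theory.
Import numFieldNormedType.Exports.

Local Open Scope classical_set_scope.
Local Open Scope ring_scope.

Section subspace_metric.
Context {R : realType} {X : metricType R} (A : set X).

Definition set_type_mdist (x y : A) : R := mdist (set_val x) (set_val y).

Let set_type_mdist_ge0 x y : 0 <= set_type_mdist x y.
Proof. exact: mdist_ge0. Qed.

Let set_type_mdist_positivity x y : set_type_mdist x y = 0 -> x = y.
Proof. by move=> /mdist_positivity /val_inj. Qed.

Let set_type_ballE (x : A) d : ball x d = [set y | set_type_mdist x y < d].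
Proof. by rewrite /ball /= /initial_ball ballEmdist. Qed.

HB.instance Definition _ := @PseudoMetric_isMetric.Build R (set_type A)
  set_type_mdist set_type_mdist_ge0 set_type_mdist_positivity set_type_ballE.

End subspace_metric.

Section Lspace_metric.
Context d (T : measurableType d) (R : realType).
Variables (mu : {measure set T -> \bar R}) (p : \bar R) (p1 : (1 <= p)%E).

Local Notation Lp := (LspaceType mu p1).
Local Notation "'N[ f ]" := (Lnorm mu p (EFin \o f)).

HB.instance Definition _ := gen_eqMixin Lp.
HB.instance Definition _ := gen_choiceMixin Lp.

Definition Lspace_mdist (f g : Lp) : R := fine 'N[(f : T -> R) \- (g : T -> R)].

Let mf (f : Lp) : measurable_fun [set: T] (f : T -> R).
Proof.
move=> m A mA.
exact: (@measurable_funPT _ _ _ _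
  (repr (f : {mfun_ mu, T >-> measurableTypeR R})) m A mA).
Qed.

Let mB (f g : Lp) : measurable_fun [set: T] ((f : T -> R) \- (g : T -> R)).
Proof. exact: measurable_funB. Qed.

Let Lspace_normN (h : T -> R) : 'N[\- h] = 'N[h].
Proof.
by rewrite (_ : _ \o _ = \- (EFin \o h))%E//; exact: oppe_Lnorm.
Qed.

Let Lspace_mdistE f g :
  (Lspace_mdist f g)%:E = 'N[(f : T -> R) \- (g : T -> R)].
Proof.
rewrite /Lspace_mdist fineK// fin_numElt (lt_le_trans ltNy0) ?Lnorm_ge0//=.
have -> : (f : T -> R) \- (g : T -> R) = (f : T -> R) \+ (\- (g : T -> R)).
  by apply/funext.
apply: (le_lt_trans (eminkowski _ _ _ p1)) => //.
  exact: measurableT_comp.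
by rewrite Lspace_normN lte_add_pinfty//; exact: Lebesgue_finite.
Qed.

Let Lspace_mdistxx f : Lspace_mdist f f = 0.
Proof.
apply/EFin_inj; rewrite Lspace_mdistE (_ : EFin \o _ = cst 0%E); last first.
  by apply/funext => x /=; rewrite subrr.
by rewrite Lnorm0// gt_eqF// (lt_le_trans _ p1).
Qed.

Let Lspace_mdist_positivity f g : Lspace_mdist f g = 0 -> f = g.
Proof.
move=> fg0.
have {}fg0 : 'N[(f : T -> R) \- (g : T -> R)] = 0%E.
  by rewrite -Lspace_mdistE fg0.
have fg : (f : T -> R) = (g : T -> R) %[ae mu].
  have /measurable_EFinP m := mB f g.
  have := Lnorm_eq0_eq0 m (lt_le_trans lte01 p1) fg0.
  apply: filterS => x /(_ I)[] /eqP.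
  by rewrite subr_eq0 => /eqP.
move: f g fg {fg0} => [f [[Pf]]] [g [[Pg]]] /= fg.
have fgE : f = g.
  rewrite -(reprK f) -(reprK g).
  by apply/eqmodP/asboolP.
by move: Pf; rewrite fgE => Pf; rewrite (Prop_irrelevance Pf Pg).
Qed.

Let Lspace_mdist_sym f g : Lspace_mdist f g = Lspace_mdist g f.
Proof.
apply/EFin_inj; rewrite !Lspace_mdistE -Lspace_normN; congr (Lnorm _ _ _).
by apply/funext => x /=; rewrite opprB.
Qed.

Let Lspace_mdist_triangle g f h :
  Lspace_mdist f h <= Lspace_mdist f g + Lspace_mdist g h.
Proof.
rewrite -lee_fin EFinD !Lspace_mdistE.
rewrite (_ : (f : T -> R) \- (h : T -> R) =
  ((f : T -> R) \- (g : T -> R)) \+ ((g : T -> R) \- (h : T -> R))); last first.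
  by apply/funext => x /=; rewrite addrA subrK.
exact: eminkowski.
Qed.

HB.instance Definition _ := isMetric.Build R Lp Lspace_mdistxx
  Lspace_mdist_positivity Lspace_mdist_sym Lspace_mdist_triangle.

End Lspace_metric.

Section distortion.
Context {R : realType}.
Implicit Types X Y : metricType R.

(* The supremum is taken in [0, +oo], hence the extra element 0: it matters
   only when X has at most one point. *)
Definition lip_norm X Y (f : X -> Y) : \bar R :=
  ereal_sup (0%E |` [set (mdist (f z.1) (f z.2) / mdist z.1 z.2)%:E
                    | z in [set z : X * X | z.1 <> z.2]]).

(* For injective f, the inverse of f as a function on the metric subspace f(X)
   of Y *)
Definition range_inv X Y (f : X -> Y) (y : set_type (range f)) : X :=
  sval (cid2 (set_valP y)).

Definition distortion X Y (f : X -> Y) : \bar R :=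
  if `[< injective f >] then (lip_norm f * lip_norm (@range_inv X Y f))%E
  else +oo%E.

(* c_Y(X) *)
Definition distortion_const Y X : \bar R := ereal_inf (range (@distortion X Y)).

End distortion.

Arguments range_inv {R X Y} f y.

(* L_2 of the real line with Lebesgue measure; it is isometric to L_2([0, 1])
   and to any other separable infinite-dimensional Hilbert space. *)
Definition L2 (R : realType) : metricType R :=
  LspaceType2 (@lebesgue_measure R).

Definition c2 {R : realType} (X : metricType R) : \bar R :=
  distortion_const (L2 R) X.

(* The symmetric group as a metric space; the parameter R is the field in which
   the metric takes its values. *)
Definition symH (R : realType) (n : nat) : Type := {perm 'I_n}.

Section symH_metric.
Context (R : realType) (n : nat).

HB.instance Definition _ := Finite.on (symH R n).

Definition symH_mdist (s t : symH R n) : R :=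
  #|[set i : 'I_n | (s : {perm 'I_n}) i != (t : {perm 'I_n}) i]%SET|%:R.

Let symH_mdistxx s : symH_mdist s s = 0.
Proof.
rewrite /symH_mdist (_ : finset _ = finset.set0) ?cards0//.
by apply/setP => i; rewrite !inE eqxx.
Qed.

Let symH_mdist_positivity s t : symH_mdist s t = 0 -> s = t.
Proof.
move=> /eqP; rewrite pnatr_eq0 cards_eq0 => /eqP/setP st.
by apply/permP => i; move: (st i); rewrite !inE => /negbFE/eqP.
Qed.

Let symH_mdist_sym s t : symH_mdist s t = symH_mdist t s.
Proof.
by congr (_%:R); apply: eq_card => i; rewrite !inE eq_sym.
Qed.

Let symH_mdist_triangle t s u :
  symH_mdist s u <= symH_mdist s t + symH_mdist t u.
Proof.
rewrite -natrD ler_nat; apply: leq_trans (leq_card_setU _ _).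
apply: subset_leq_card; apply/fintype.subsetP => i; rewrite !inE.
by apply: contraNT; rewrite negb_or !negbK => /andP[/eqP-> /eqP->].
Qed.

HB.instance Definition _ := isMetric.Build R (symH R n) symH_mdistxx
  symH_mdist_positivity symH_mdist_sym symH_mdist_triangle.

End symH_metric.

(* Main.v *)
(* Upper bound: sending a permutation to its permutation matrix turns d into
   half the square of the Euclidean distance, and d takes values in
   {0} \cup [1, n]. Lower bound: k = n / 2 disjoint transpositions generate a
   copy of the Hamming cube of dimension k. Enflo's argument for the cube runs
   directly on the whole group: the short diagonals inequality, summed over the
   quadrilaterals (g, gu, gut, gt), shows that the quantity
   \sum_g |f(g) - f(gu)|^2 is subadditive on commuting involutions u, t. *)
From HB Require Import structures.
Require Import Defs.
From mathcomp Require Import all_boot all_order all_algebra fingroup perm.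
From mathcomp Require Import all_classical all_reals all_analysis.
From mathcomp Require Import ring lra zify.
From mathcomp Require Import measurable_realfun.

Import Order.TTheory GRing.Theory Num.Theory.
Import numFieldNormedType.Exports.

Local Open Scope classical_set_scope.
Local Open Scope ring_scope.

(** * Squared distances in L_2 as integrals, and short diagonals *)

Section L2_metric.
Context {d : measure_display} {T : measurableType d} {R : realType}.
Variable mu : {measure set T -> \bar R}.
Implicit Types f g : LspaceType2 mu.

Lemma measurable_L2 f : measurable_fun [set: T] (f : T -> R).
Proof.
move=> m A mA.
exact: (@measurable_funPT _ _ _ _
  (generic_quotient.repr (f : {mfun_ mu, T >-> measurableTypeR R})) m A mA).
Qed.

Lemma measurable_L2_sqrB f g :
  measurable_fun [set: T] (fun x => (((f x : R) - (g x : R)) ^+ 2)%:E).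
Proof.
apply/measurable_EFinP/measurable_funX/measurable_funB; exact: measurable_L2.
Qed.

Lemma sqr_Lnorm2 (h : T -> R) :
  ('N[mu]_2%:E[EFin \o h] `^ 2 = \int[mu]_x (h x ^+ 2)%R%:E)%E.
Proof.
rewrite poweR_Lnorm ?pnatr_eq0//; apply: eq_integral => x _ /=.
by rewrite powR_mulrn// -normrX ger0_norm ?sqr_ge0.
Qed.

(** The distance is [fine] of an extended real norm. Minkowski's inequality makes that norm finite,
    so nothing is lost when passing to the integral. *)
Lemma mdist_L2E f g :
  (mdist f g ^+ 2)%:E = (\int[mu]_x (((f x : R) - (g x : R)) ^+ 2)%R%:E)%E.
Proof.
have Nfin : ('N[mu]_2%:E[EFin \o (fun x => (f x : R) - (g x : R))%R] < +oo)%E.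
  rewrite (_ : EFin \o _ = EFin \o ((f : T -> R) \+ (\- (g : T -> R))))//.
  apply: (le_lt_trans (eminkowski _ _ _ (lee1n 2))).
  - exact: measurable_L2.
  - by apply: measurableT_comp => //; exact: measurable_L2.
  rewrite (_ : EFin \o (\- (g : T -> R))%R = \- (EFin \o (g : T -> R)))%E//.
  rewrite oppe_Lnorm lte_add_pinfty//; exact: Lebesgue_finite.
rewrite -sqr_Lnorm2 -[X in (X `^ _)%E]fineK; last first.
  by rewrite ge0_fin_numE// Lnorm_ge0.
by rewrite poweR_EFin powR_mulrn ?fine_ge0 ?Lnorm_ge0.
Qed.

(** The inequality already holds pointwise for real numbers: the four squared sides minus the two
    squared diagonals equal (a + c - b - e)^2. It is then integrated. *)
Lemma L2_short_diagonals (a b c e : LspaceType2 mu) :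
  mdist a c ^+ 2 + mdist b e ^+ 2 <=
  mdist a b ^+ 2 + mdist b c ^+ 2 + (mdist c e ^+ 2 + mdist e a ^+ 2).
Proof.
have m := measurable_L2_sqrB.
have s0 (x y : R) : (0 <= ((x - y) ^+ 2)%:E)%E by rewrite lee_fin sqr_ge0.
have sD (u v w z : LspaceType2 mu) : (mdist u v ^+ 2 + mdist w z ^+ 2)%:E =
    (\int[mu]_x ((((u x : R) - (v x : R)) ^+ 2)%R%:E +
                 (((w x : R) - (z x : R)) ^+ 2)%R%:E))%E.
  by rewrite EFinD !mdist_L2E ge0_integralD.
have s2 (u v w z : LspaceType2 mu) x : [set: T] x ->
    (0 <= (((u x : R) - (v x : R)) ^+ 2)%R%:E +
          (((w x : R) - (z x : R)) ^+ 2)%R%:E)%E by rewrite adde_ge0.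
rewrite -lee_fin [leRHS]EFinD !sD -ge0_integralD//;
  try exact: emeasurable_funD; try exact: s2.
apply: ge0_le_integral => //; try exact: s2.
- exact: emeasurable_funD.
- by apply: emeasurable_funD; apply: emeasurable_funD.
move=> x _; rewrite -!EFinD lee_fin -subr_ge0.
have -> : (a x - b x) ^+ 2 + (b x - c x) ^+ 2 +
    ((c x - e x) ^+ 2 + (e x - a x) ^+ 2) -
    ((a x - c x) ^+ 2 + (b x - e x) ^+ 2) = (a x + c x - b x - e x) ^+ 2.
  by ring.
exact: sqr_ge0.
Qed.

End L2_metric.

(** * Enflo's argument on a finite group *)

Section enflo.
Context {R : realType} {Y : metricType R} {gT : finGroupType}.
Hypothesis short_diagonals : forall a b c e : Y,
  mdist a c ^+ 2 + mdist b e ^+ 2 <=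
  mdist a b ^+ 2 + mdist b c ^+ 2 + (mdist c e ^+ 2 + mdist e a ^+ 2).

Definition energy (f : gT -> Y) (u : gT) : R :=
  \sum_(g : gT) mdist (f g) (f (g * u)%g) ^+ 2.

(* As u and t are commuting involutions, both diagonals of the quadrilaterals
   (g, gu, gut, gt) contribute the energy of ut, and opposite sides contribute
   the same. *)
Lemma energyM (f : gT -> Y) (u t : gT) :
  commute u t -> (u * u = 1)%g -> (t * t = 1)%g ->
  energy f (u * t)%g <= energy f u + energy f t.
Proof.
move=> ut u2 t2.
(* Translation invariance of the sum over the group brings every side and diagonal to the form of a
   summand of [energy]. *)
have re (h : gT) (F : gT -> R) : \sum_g F (g * h)%g = \sum_g F g.
  by rewrite [RHS](reindex_inj (mulIg h)).
have ge0D : 0 <= (energy f u + energy f t - energy f (u * t)%g) *+ 2.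
  have -> : (energy f u + energy f t - energy f (u * t)%g) *+ 2 =
      \sum_g (mdist (f g) (f (g * u)%g) ^+ 2 +
               mdist (f (g * u)%g) (f (g * (u * t))%g) ^+ 2 +
              (mdist (f (g * (u * t))%g) (f (g * t)%g) ^+ 2 +
               mdist (f (g * t)%g) (f g) ^+ 2) -
              (mdist (f g) (f (g * (u * t))%g) ^+ 2 +
               mdist (f (g * u)%g) (f (g * t)%g) ^+ 2)).
    rewrite sumrB !big_split/=.
    have -> : \sum_g mdist (f (g * u)%g) (f (g * (u * t))%g) ^+ 2 = energy f t.
      rewrite /energy -(re u (fun h => mdist (f h) (f (h * t)%g) ^+ 2)).
      by apply: eq_bigr => g _; rewrite mulgA.
    have -> : \sum_g mdist (f (g * (u * t))%g) (f (g * t)%g) ^+ 2 = energy f u.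
      rewrite /energy -(re (u * t)%g (fun h => mdist (f h) (f (h * u)%g) ^+ 2)).
      by apply: eq_bigr => g _; rewrite ut -2!mulgA u2 mulg1.
    have -> : \sum_g mdist (f (g * t)%g) (f g) ^+ 2 = energy f t.
      rewrite /energy -(re t (fun h => mdist (f h) (f (h * t)%g) ^+ 2)).
      by apply: eq_bigr => g _; rewrite -mulgA t2 mulg1.
    have -> : \sum_g mdist (f (g * u)%g) (f (g * t)%g) ^+ 2 =
        energy f (u * t)%g.
      rewrite /energy -(re u (fun h => mdist (f h) (f (h * (u * t))%g) ^+ 2)).
      by apply: eq_bigr => g _; rewrite -(mulgA g u) (mulgA u u) u2 mul1g.
    rewrite /energy; ring.
  by apply: sumr_ge0 => g _; rewrite subr_ge0.
by move: ge0D; rewrite pmulrn_lge0// subr_ge0.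
Qed.

End enflo.

(** * Enflo's inequality for the symmetric group *)

Section symmetric_group.
Context {R : realType} {Y : metricType R} {n : nat}.
Hypothesis short_diagonals : forall a b c e : Y,
  mdist a c ^+ 2 + mdist b e ^+ 2 <=
  mdist a b ^+ 2 + mdist b c ^+ 2 + (mdist c e ^+ 2 + mdist e a ^+ 2).

(** Products apply the left factor first, so [s] and [s * t] differ at [i] exactly when [t] moves
    [s i]; thus [s] maps the points of difference bijectively onto the support of [t]. *)
Lemma symH_mdistMr (s t : {perm 'I_n}) :
  mdist (s : symH R n) (s * t : symH R n)%g = #|[set i | t i != i]%SET|%:R.
Proof.
rewrite -[LHS]/(symH_mdist (s : symH R n) (s * t : symH R n)%g); congr _%:R.
rewrite -(card_imset [set i | t i != i]%SET (@perm_inj _ s^-1)).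
apply: eq_card => i; apply/idP/imsetP; rewrite inE permM.
  by move=> si; exists (s i); rewrite ?permK// inE eq_sym.
by move=> [j]; rewrite inE => tj ->; rewrite permKV eq_sym.
Qed.

(* The involution u is a product of k disjoint transpositions. *)
Lemma exists_low_energy_involution (f : {perm 'I_n} -> Y) (L : R) (k : nat) :
  (forall (g : {perm 'I_n}) (a b : 'I_n), a != b ->
     mdist (f g) (f (g * tperm a b)%g) <= L) ->
  (k.*2 <= n)%N ->
  exists u : {perm 'I_n}, [/\ (u * u = 1)%g,
    #|[set i | u i != i]%SET| = k.*2 &
    energy f u <= k%:R * L ^+ 2 * #|{perm 'I_n}|%:R].
Proof.
move=> fL; elim: k => [_|k IH].
  exists 1%g; split; first by rewrite mulg1.
    by apply: eq_card0 => i; rewrite inE perm1 eqxx.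
  rewrite !mul0r /energy big1// => g _.
  by rewrite mulg1 mdistxx expr0n.
rewrite doubleS => kn; have [|u [u2 cu Eu]] := IH; first by lia.
set S := [set i | u i != i]%SET in cu.
(* [u] moves 2k of at least 2k + 2 points, which leaves two fixed points for a further disjoint
   transposition. *)
have : (1 < #|~: S|)%N.
  by have := cardsC S; rewrite cu card_ord; lia.
case/card_gt1P => a [b [aS bS ab]].
have ua : u a = a by move: aS; rewrite !inE negbK => /eqP.
have ub : u b = b by move: bS; rewrite !inE negbK => /eqP.
have ut : commute u (tperm a b).
  by rewrite /commute [RHS]conjgC tpermJ ua ub.
exists (u * tperm a b)%g; split.
- by rewrite {1}ut -mulgA (mulgA u) u2 mul1g tperm2.
- have -> : [set i | (u * tperm a b)%g i != i]%SET = (a |: (b |: S))%SET.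
    apply/setP => i; rewrite !inE permM.
    have [->|ia] := eqVneq i a; first by rewrite ua tpermL eq_sym ab.
    have [->|ib] := eqVneq i b; first by rewrite ub tpermR ab.
    rewrite tpermD//.
      by apply: contraNneq ia => aui; apply/eqP/(@perm_inj _ u); rewrite ua.
    by apply: contraNneq ib => aui; apply/eqP/(@perm_inj _ u); rewrite ub.
  rewrite !cardsU1 cu !inE (negbTE ab)/= ua ub !eqxx/=; lia.
apply: le_trans (energyM short_diagonals _ _ _ ut u2 (tperm2 _ _)) _.
rewrite -natr1 2!mulrDl mul1r lerD// /energy.
rewrite -sum1_card natr_sum mulr_sumr ler_sum// => g _.
have le0 := mdist_ge0 (f g) (f (g * tperm a b)%g).
have leL := fL g a b ab.
by rewrite mulr1 lerXn2r ?nnegrE// (le_trans le0).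
Qed.

(** Compare two bounds on the energy of a product [u] of k disjoint transpositions. As [u] moves 2k
    points, M^2 times the energy is at least (2k)^2 |S_n|; subadditivity bounds the energy by k
    (2L)^2 |S_n|. *)
Lemma sym_enflo (f : {perm 'I_n} -> Y) (L M : R) (k : nat) :
  (k.*2 <= n)%N -> 0 <= M ->
  (forall g h : {perm 'I_n},
     mdist (f g) (f h) <= L * mdist (g : symH R n) (h : symH R n)) ->
  (forall g h : {perm 'I_n},
     mdist (g : symH R n) (h : symH R n) <= M * mdist (f g) (f h)) ->
  k%:R <= (L * M) ^+ 2.
Proof.
move=> kn M0 fL fM.
have [->|k0] := eqVneq k 0%N; first exact: sqr_ge0.
(* The factor 2 in [L * 2] is the number of points moved by a transposition. *)
have [|u [u2 cu Eu]] := exists_low_energy_involution f (L * 2) k _ kn.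
  move=> g a b ab; apply: le_trans (fL _ _) _; rewrite symH_mdistMr.
  rewrite (_ : [set i | _]%SET = [set a; b]%SET) ?cards2 ?ab//.
  apply/setP => i; rewrite !inE; case: tpermP => [->|->|/eqP ia /eqP ib].
  - by rewrite eqxx eq_sym ab.
  - by rewrite eqxx orbT ab.
  - by rewrite eqxx (negbTE ia) (negbTE ib).
have card0 : 0 < #|{perm 'I_n}|%:R :> R.
  by rewrite ltr0n; apply/card_gt0P; exists 1%g.
have kpos : 0 < k%:R :> R by rewrite ltr0n lt0n.
have low : (k.*2)%:R ^+ 2 * #|{perm 'I_n}|%:R <= M ^+ 2 * energy f u.
  rewrite /energy -sum1_card natr_sum !mulr_sumr ler_sum// => g _.
  rewrite mulr1 -exprMn ler_sqr ?nnegrE ?ler0n ?mulr_ge0 ?mdist_ge0//.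
  by apply: le_trans (fM _ _); rewrite symH_mdistMr cu.
have M2 : 0 <= M ^+ 2 := sqr_ge0 M.
have {}low := le_trans low (ler_wpM2l M2 Eu).
have {low} : (k%:R ^+ 2 * 4) * #|{perm 'I_n}|%:R <=
    (k%:R * ((L * M) ^+ 2 * 4)) * #|{perm 'I_n}|%:R.
  move: low; rewrite -mul2n natrM; move: (k%:R) (#|_|%:R) => x y.
  by congr (_ <= _); ring.
rewrite ler_pM2r// expr2 -mulrA ler_pM2l// ler_pM2r//.
Qed.

End symmetric_group.

(** * Lipschitz norms and distortion *)

Section distortion_theory.
Context {R : realType} {X Y : metricType R}.
Implicit Type f : X -> Y.

Lemma lip_norm_ub f {x y} : x <> y ->
  ((mdist (f x) (f y) / mdist x y)%:E <= lip_norm f)%E.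
Proof. by move=> xy; apply: ereal_sup_ubound; right; exists (x, y). Qed.

Lemma lip_norm_ge0 f : (0 <= lip_norm f)%E.
Proof. by apply: ereal_sup_ubound; left. Qed.

Lemma lip_norm_le f L : 0 <= L ->
  (forall x y, mdist (f x) (f y) <= L * mdist x y) -> (lip_norm f <= L%:E)%E.
Proof.
move=> L0 fL; apply: ge_ereal_sup => _ [->|[[x y] /= xy <-]].
  by rewrite lee_fin.
by rewrite lee_fin ler_pdivrMr// mdist_gt0; apply/eqP.
Qed.

Lemma lip_normP {f L} : lip_norm f = L%:E ->
  forall x y, mdist (f x) (f y) <= L * mdist x y.
Proof.
move=> fL x y; have [->|xy] := eqVneq x y; first by rewrite !mdistxx mulr0.
rewrite -ler_pdivrMr ?mdist_gt0// -lee_fin -fL.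
by apply: lip_norm_ub; apply/eqP.
Qed.

Lemma lip_norm_gt0 {f} {x y : X} : injective f -> x <> y -> (0 < lip_norm f)%E.
Proof.
move=> finj xy; apply: lt_le_trans (lip_norm_ub _ xy).
by rewrite lte_fin divr_gt0// mdist_gt0; apply/eqP => // /finj.
Qed.

End distortion_theory.

Section distortion_bounds.
Context {R : realType} {X Y : metricType R}.
Variable f : X -> Y.

Let to_range (x : X) : set_type (range f) :=
  SigSub (mem_set (imageT f x)).

Lemma range_inv_range y : f (range_inv f y) = set_val y.
Proof. by rewrite /range_inv; case: cid2. Qed.

(** The bound with [M] forces injectivity, since points with equal images are then at distance 0. *)
Lemma distortion_le (L M : R) : 0 <= L -> 0 <= M ->
  (forall x y, mdist (f x) (f y) <= L * mdist x y) ->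
  (forall x y, mdist x y <= M * mdist (f x) (f y)) ->
  (distortion f <= (L * M)%:E)%E.
Proof.
move=> L0 M0 fL fM; have finj : injective f.
  move=> x y fxy; apply: mdist_positivity; apply/eqP.
  by rewrite eq_le mdist_ge0 andbT (le_trans (fM x y))// fxy mdistxx mulr0.
rewrite /distortion asboolT// EFinM lee_pmul ?lip_norm_ge0//.
  exact: lip_norm_le.
by apply: lip_norm_le => // x y; rewrite (le_trans (fM _ _))// !range_inv_range.
Qed.

(** Reduces a lower bound to real Lipschitz constants: if [f] is not injective, or either norm is
    infinite, the distortion is +oo. Two distinct points make both norms positive, which excludes
    the product 0 * +oo, equal to 0 by convention. *)
Lemma distortion_ge (K : R) (x0 y0 : X) : x0 <> y0 ->
  (forall L M, 0 <= L -> 0 <= M ->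
    (forall x y, mdist (f x) (f y) <= L * mdist x y) ->
    (forall x y, mdist x y <= M * mdist (f x) (f y)) -> K <= L * M) ->
  (K%:E <= distortion f)%E.
Proof.
move=> xy0 fK; rewrite /distortion; case: asboolP => finj; last exact: leey.
have invK x : range_inv f (to_range x) = x.
  by apply: finj; rewrite range_inv_range.
have L0 := lip_norm_gt0 finj xy0.
have M0 : (0 < lip_norm (range_inv f))%E.
  apply: (@lip_norm_gt0 _ _ _ (range_inv f) (to_range x0) (to_range y0)).
    move=> u v uv; apply: val_inj; rewrite -set_valE.
    by rewrite -range_inv_range uv range_inv_range.
  by move=> /(congr1 (range_inv f)); rewrite !invK.
case EL: (lip_norm f) L0 => [L| |] // L0; last by rewrite gt0_mulye ?leey.
case EM: (lip_norm _) M0 => [M| |] // M0; last by rewrite gt0_muley ?leey.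
rewrite !lte_fin in L0 M0; rewrite -EFinM lee_fin fK ?ltW//.
  exact: lip_normP.
move=> x y; have := lip_normP EM (to_range x) (to_range y).
by rewrite !invK.
Qed.

End distortion_bounds.

(** * Finite-dimensional Euclidean spaces inside L_2 *)

Lemma exists_L2 {d : measure_display} {T : measurableType d} {R : realType}
    (mu : {measure set T -> \bar R}) (h : T -> R) :
  measurable_fun [set: T] h -> (\int[mu]_x (h x ^+ 2)%R%:E < +oo)%E ->
  exists f : LspaceType2 mu, ae_eq mu [set: T] (f : T -> R) h.
Proof.
move=> mh h2.
pose m : {mfun T >-> measurableTypeR R} :=
  mfun_Sub (mem_set mh : (h : T -> measurableTypeR R) \in mfun).
pose q : {mfun_ mu, T >-> measurableTypeR R} := \pi_(_)%qT m.
pose q' : T -> R := aqEqMfun_to_fun q.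
(* The representative chosen in the class of [h] agrees with [h] only almost everywhere, which
   suffices for integrals. *)
have qh : ae_eq mu [set: T] q' h.
  have : ae_eq_op mu (generic_quotient.repr q) m by rewrite -eqmodE reprK.
  by move=> /asboolP; apply: filterS => x /(_ I).
have q2 : finite_norm mu 2%:E (aqEqMfun_to_fun q).
  rewrite /finite_norm; apply: (@lty_poweRy _ _ 2) => //.
  rewrite sqr_Lnorm2; apply: le_lt_trans h2; rewrite le_eqVlt; apply/orP; left.
  apply/eqP; apply: ge0_ae_eq_integral => //.
  - apply/measurable_EFinP/measurable_funX.
    exact: (@measurable_funPT _ _ _ _ (generic_quotient.repr q)).
  - by apply/measurable_EFinP/measurable_funX.
  - by move=> x _; rewrite lee_fin sqr_ge0.
  - by move=> x _; rewrite lee_fin sqr_ge0.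
  - by apply: filterS qh => x /= + /[dup] => /[apply]; rewrite /q' => ->.
pose f : LspaceType2 mu :=
  HB.pack_for (LspaceType2 mu) q (isFinLebesgue.Build _ _ _ _ _ (lee1n 2) q q2).
by exists f.
Qed.

Section step_functions.
Context {R : realType} {J : finType}.
Local Notation mu := (@lebesgue_measure R).

(** Disjoint intervals of length one, so their indicators form an orthonormal family indexed by
    [J]. *)
Let cell (i : J) : set (measurableTypeR R) :=
  [set` `[(enum_rank i)%:R, (enum_rank i)%:R + 1[%R].

Let measurable_cell i : measurable (cell i).
Proof. exact: measurable_itv. Qed.

Let mu_cell i : mu (cell i) = 1%E.
Proof.
rewrite /cell lebesgue_measure_itv/= lte_fin ltrDl ltr01 -EFinB.
by rewrite addrAC subrr add0r.
Qed.

Let cell_inj {i j x} : cell i x -> cell j x -> i = j.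
Proof.
rewrite /cell/= !in_itv/= => /andP[ix xi] /andP[jx xj].
apply/enum_rank_inj/val_inj/eqP => /=.
have := le_lt_trans ix xj; have := le_lt_trans jx xi.
by rewrite !natr1 !ltr_nat !ltnS eqn_leq => -> ->.
Qed.

Let step (a : J -> R) (x : R) : R := \sum_i a i * \1_(cell i) x.

(** The cells are disjoint, so at most one term is nonzero at [x] and no cross terms appear. *)
Let step_sqr a x : step a x ^+ 2 = \sum_i a i ^+ 2 * \1_(cell i) x.
Proof.
rewrite /step; have [[i xi]|no] := pselect (exists i, cell i x).
  have nj j : j != i -> \1_(cell j) x = 0 :> R.
    move=> ji; rewrite indicE memNset// => xj.
    by rewrite (cell_inj xj xi) eqxx in ji.
  rewrite (bigD1 i)// [in RHS](bigD1 i)//= !big1 ?addr0.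
  - by rewrite indicE mem_set// !mulr1.
  - by move=> j /nj ->; rewrite mulr0.
  - by move=> j /nj ->; rewrite mulr0.
have n0 i : \1_(cell i) x = 0 :> R.
  by rewrite indicE memNset// => xi; apply: no; exists i.
by rewrite !big1 ?expr0n// => i _; rewrite n0 mulr0.
Qed.

Let measurable_step a : measurable_fun [set: measurableTypeR R] (step a).
Proof.
by apply: measurable_sum => i; apply: measurable_funM.
Qed.

Let integral_step_sqr a :
  (\int[mu]_x (step a x ^+ 2)%R%:E = (\sum_i a i ^+ 2)%:E)%E.
Proof.
under eq_integral do rewrite step_sqr -sumEFin.
rewrite ge0_integral_sum//.
- rewrite -sumEFin; apply: eq_bigr => i _.
  under eq_integral do rewrite EFinM.
  rewrite ge0_integralZl//.
  + rewrite integral_indic// setIT -[RHS]mule1; congr (_ * _)%E.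
    exact: mu_cell.
  + by apply/measurable_EFinP; exact: measurable_indic.
  + by rewrite lee_fin sqr_ge0.
- by move=> i; apply/measurable_EFinP; apply: measurable_funM.
- by move=> i x _; rewrite lee_fin mulr_ge0// sqr_ge0.
Qed.

(** [F a] is a class of [step a]. Since [step] is linear in the coefficients, the distance reduces
    to the norm of a single step function. *)
Lemma exists_L2_isometry : exists F : (J -> R) -> L2 R,
  forall a b, mdist (F a) (F b) ^+ 2 = \sum_i (a i - b i) ^+ 2.
Proof.
have /choice[F FE] (a : J -> R) := exists_L2 mu (step a) (measurable_step a)
  ltac:(by rewrite integral_step_sqr ltry).
exists F => a b; apply: EFin_inj; rewrite mdist_L2E -integral_step_sqr.
apply: ge0_ae_eq_integral => //.
- exact: measurable_L2_sqrB.
- by apply/measurable_EFinP/measurable_funX; exact: measurable_step.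
- by move=> x _; rewrite lee_fin sqr_ge0.
- by move=> x _; rewrite lee_fin sqr_ge0.
apply: filterS2 (FE a) (FE b) => x /= + + _ => /(_ I) -> /(_ I) ->.
by rewrite /step -sumrB; under [in RHS]eq_bigr do rewrite mulrBl.
Qed.

End step_functions.

(** * The two bounds on [c2] *)

Section c2_symH.
Context {R : realType} {n : nat}.

Lemma c2_symH_ge : (2 <= n)%N ->
  ((2^-1 * Num.sqrt n%:R)%:E <= c2 (symH R n))%E.
Proof.
move=> n2; apply: le_ereal_inf_tmp => _ [f _ <-].
pose i0 : 'I_n := Ordinal (ltnW n2); pose i1 : 'I_n := Ordinal n2.
apply: (@distortion_ge R (symH R n) (L2 R) f _ (1%g : {perm 'I_n}) (tperm i0 i1)).
  by move=> /permP/(_ i0); rewrite perm1 tpermL.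
move=> L M L0 M0 fL fM.
have kn : (n./2.*2 <= n)%N by lia.
have nLM : n%:R <= (2 * (L * M)) ^+ 2.
  have := sym_enflo (@L2_short_diagonals _ _ _ lebesgue_measure) f L M n./2
    kn M0 fL fM.
  (* With k = [n./2] and n at least 2, n <= 2k + 1 <= 4k. The factor 4 is the square of the 2 in
     [nLM]. *)
  have : n%:R <= 4 * (n./2)%:R :> R by rewrite -natrM ler_nat; lia.
  by rewrite exprMn; lra.
have := ler_wsqrtr nLM.
rewrite sqrtr_sqr ger0_norm ?mulr_ge0//.
by lra.
Qed.

(** Row [i] contributes 0 if [s] and [t] agree at [i]; otherwise it has two nonzero entries, 1 and
    -1, and contributes 2. *)
Let perm_mx_dist (s t : {perm 'I_n}) :
  \sum_(p : 'I_n * 'I_n) ((s p.1 == p.2)%:R - (t p.1 == p.2)%:R) ^+ 2 =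
  2 * mdist (s : symH R n) (t : symH R n).
Proof.
rewrite -(pair_bigA _ (fun i j => ((s i == j)%:R - (t i == j)%:R) ^+ 2))/=.
rewrite -[mdist _ _]/(symH_mdist (s : symH R n) t) /symH_mdist -sum1_card.
rewrite natr_sum mulr_sumr [RHS]big_mkcond/=; apply: eq_bigr => i _.
rewrite inE; have [->|st] /= := eqVneq (s i) (t i).
  by rewrite big1// => j _; rewrite subrr expr0n.
have ts : t i != s i by rewrite eq_sym.
rewrite (bigD1 (s i))//= (bigD1 (t i))//= big1 ?addr0.
  by rewrite !eqxx (negbTE st) (negbTE ts) subr0 sub0r sqrrN expr1n mulr1.
move=> j /andP[js jt].
by rewrite ![_ == j]eq_sym (negbTE js) (negbTE jt) subrr expr0n.
Qed.

Lemma c2_symH_le : (c2 (symH R n) <= (Num.sqrt n%:R)%:E)%E.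
Proof.
have [F FE] := @exists_L2_isometry R ('I_n * 'I_n)%type.
pose f (s : symH R n) : L2 R := F (fun p => ((s : {perm 'I_n}) p.1 == p.2)%:R).
have fE s t : mdist (f s) (f t) ^+ 2 = 2 * mdist s t by rewrite FE perm_mx_dist.
(* The two factors are the Lipschitz constants of [f] and of its inverse: integrality of d gives 2d
   <= 2d^2, and d <= n gives d^2 <= (n / 2)(2d). *)
have sqrt_n : Num.sqrt n%:R = Num.sqrt 2 * Num.sqrt (n%:R / 2) :> R.
  by rewrite -sqrtrM ?ler0n// mulrCA mulfV ?mulr1// pnatr_eq0.
rewrite sqrt_n.
have mdist_nat (s t : symH R n) : exists2 k, (k <= n)%N & mdist s t = k%:R :> R.
  by eexists; last reflexivity; rewrite (leq_trans (max_card _))// card_ord.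
apply: (@le_trans _ _ (distortion f)).
  by apply: ereal_inf_lbound; exists f.
apply: distortion_le; rewrite ?sqrtr_ge0//.
- move=> s t; rewrite -ler_sqr ?nnegrE ?mulr_ge0 ?sqrtr_ge0 ?mdist_ge0//.
  rewrite fE exprMn sqr_sqrtr ?ler0n// ler_pM2l ?ltr0n//.
  by have [k _ ->] := mdist_nat s t; rewrite -natrX ler_nat; nia.
- move=> s t; rewrite -ler_sqr ?nnegrE ?mulr_ge0 ?sqrtr_ge0 ?mdist_ge0//.
  rewrite exprMn fE sqr_sqrtr ?divr_ge0 ?ler0n// mulrA divfK ?pnatr_eq0//.
  by have [k kn ->] := mdist_nat s t; rewrite -natrX -natrM ler_nat; nia.
Qed.

End c2_symH.

(** * Logarithmic asymptotics of the factorial *)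

Section factorial_asymptotics.
Context {R : realType}.
Implicit Type n : nat.

Let fact_pos n : 0 < (n`!)%:R :> R.
Proof. by rewrite ltr0n fact_gt0. Qed.

(** This is n! <= n^n after taking logarithms. *)
Lemma ln_fact_le n : ln (n`!)%:R <= n%:R * ln n%:R :> R.
Proof.
case: n => [|n]; first by rewrite ln1 mul0r.
rewrite mulr_natl -lnXn ?ltr0n// ler_ln ?posrE ?exprn_gt0 ?ltr0n ?fact_gt0// -natrX.
rewrite ler_nat; elim: n => // n IH; rewrite factS expnS leq_mul2l/=.
by rewrite (leq_trans IH)// leq_exp2r.
Qed.

(* Keep only the n-th term of the series of e^n. *)
Lemma ln_fact_ge n : n%:R * ln n%:R - n%:R <= ln (n`!)%:R :> R.
Proof.
case: n => [|n]; first by rewrite ln1 mul0r subr0.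
have n0 : 0 < n.+1%:R :> R by rewrite ltr0n.
rewrite lerBlDr mulr_natl -lnXn// -[X in _ + X]expRK -lnM ?posrE ?expR_gt0//.
rewrite ler_ln ?posrE ?exprn_gt0 ?mulr_gt0 ?expR_gt0// mulrC -ler_pdivrMr//.
by have := expR_ge1Dxn n (ltW n0); lra.
Qed.

(** The threshold e^2 makes l = ln n at least 2, so A = ln n! lies between nl/2 and nl. Then n <= A
    <= n^2 puts ln A between l and 2l, and dividing gives n/4 and n. *)
Lemma ln_fact_ratio n : expR 2 <= n%:R :> R ->
  (n%:R : R) / 4 <= ln (n`!)%:R / ln (ln (n`!)%:R) <= (n%:R : R).
Proof.
move=> en; set A := ln _; set l : R := ln n%:R.
have n0 : 0 < n%:R :> R := lt_le_trans (expR_gt0 _) en.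
have l2 : 2 <= l by rewrite -[2](@expRK R) ler_ln ?posrE ?expR_gt0.
have A_le : A <= n%:R * l := ln_fact_le n.
have A_ge : n%:R * l / 2 <= A.
  by have := ln_fact_ge n; rewrite -/A -/l; nra.
have nA : n%:R <= A by nra.
have A0 : 0 < A := lt_le_trans n0 nA.
have B_ge : l <= ln A by rewrite ler_ln ?posrE.
have B_le : ln A <= 2 * l.
  rewrite mulr_natl -lnXn// ler_ln ?posrE ?exprn_gt0//.
  by rewrite (le_trans A_le)// expr2 ler_pM2l// ltW// ln_sublinear.
have B0 : 0 < ln A by lra.
by rewrite ler_pdivlMr// ler_pdivrMr//; apply/andP; split; nra.
Qed.

End factorial_asymptotics.

Theorem mainTheorem9 (R : realType) :
  (exists c C : R, [/\ 0 < c, c <= C &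
     forall n : nat, (2 <= n)%N ->
       ((c * Num.sqrt n%:R)%:E <= c2 (symH R n) <= (C * Num.sqrt n%:R)%:E)%E])
  /\
  (fun n : nat => fine (c2 (symH R n)) : R^o) =Theta_\oo
  (fun n : nat => Num.sqrt (ln (#|{: symH R n}|%:R) / ln (ln (#|{: symH R n}|%:R)))
    : R^o).
Proof.
have c2_bounds n : (2 <= n)%N ->
    ((2^-1 * Num.sqrt n%:R)%:E <= c2 (symH R n) <= (1 * Num.sqrt n%:R)%:E)%E.
  by move=> n2; rewrite c2_symH_ge//= mul1r c2_symH_le.
split.
  by exists 2^-1, 1; split; rewrite ?invr_gt0 ?invf_le1 ?ltr0n ?ler1n.
(* Both [c2] and the root of the ratio lie between sqrt(n)/2 and sqrt(n) for large n, so they differ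
   by a factor of at most 2. *)
rewrite eqThetaE qualifE; apply/asboolP; exists (2^-1, 2) => /=.
  by rewrite invr_gt0 ltr0n.
near=> n.
have n2 : (2 <= n)%N by near: n; exact: nbhs_infty_ge.
have en : expR 2 <= n%:R :> R by near: n; exact: nbhs_infty_ger.
have cardS : #|{: symH R n}| = n`! by exact: card_Sn.
have := c2_bounds n n2; have := ln_fact_ratio n en; rewrite cardS.
set q := ln _ / _ => /andP[q_ge q_le].
have sq : Num.sqrt q <= Num.sqrt n%:R by exact: ler_wsqrtr.
have sn : Num.sqrt n%:R / 2 <= Num.sqrt q.
  have s0 : 0 <= Num.sqrt n%:R / 2 :> R by rewrite divr_ge0 ?sqrtr_ge0.
  rewrite -(ger0_norm s0) -sqrtr_sqr; apply: ler_wsqrtr.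
  by rewrite expr_div_n sqr_sqrtr ?ler0n// -natrX.
(* The bounds exclude infinite values, for which [fine] would return 0. *)
case: (c2 (symH R n)) => [r| |]; rewrite ?leye_eq ?leeNy_eq ?andbF//.
rewrite !lee_fin => /andP[r_ge r_le].
rewrite /= (ger0_norm (sqrtr_ge0 q)) ger0_norm; last first.
  by have := sqrtr_ge0 (n%:R : R); lra.
by split; lra.
Unshelve. all: by end_near. Qed.
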